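(* Let $\mathbb{K}$ be an algebraically closed field and let $X \subset \mathbb{P}^r$ be a nondegenerate irreducible projective variety over $\mathbb{K}$ whose homogeneous ideal $I(X) \subset R = \mathbb{K}[z_0,\ldots,z_r]$ is generated by quadratic polynomials. Let $\{Q_0,\ldots,Q_t\}$ be a basis of the $\mathbb{K}$-vector space $I(X)_2$ of quadratic forms in $I(X)$. Let $M$ be the $(r+1)\times(r+1)$ symmetric matrix associated with the general member $Q = x_0Q_0+\cdots+x_tQ_t$, so that the entries of $M$ are linear forms in $x_0,\ldots,x_t$. For an integer $s \geq 1$ let $I(s+1,M)$ be the ideal of $\mathbb{K}[x_0,\ldots,x_t]$ generated by all $(s+1)\times(s+1)$ minors of $M$. Then $$\text{rank-index}(X) = \min\{\, s \mid \sqrt{I(s+1,M)} \text{ has no nonzero linear form}\,\}.$$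
   Context: The rank of a quadratic form is the rank of its associated symmetric matrix; for $Q=\sum_{i\le j}\alpha_{ij}z_iz_j$ this is the matrix with off-diagonal entries $\alpha_{ij}$ and diagonal entries $2\alpha_{ii}$. $X\subset\mathbb{P}^r$ satisfies property $QR(k)$ if its homogeneous ideal $I(X)$ can be generated by quadratic forms of rank at most $k$. The rank index of $X$, $\text{rank-index}(X)$, is the smallest integer $k$ such that $X$ satisfies $QR(k)$. $I(s+1,M)$ is the zero ideal when $s+1>r+1$. *)

(* Defs.v *)
From mathcomp Require Import all_boot all_order all_algebra.
From mathcomp Require Export mpoly.

Set Implicit Arguments.
Unset Strict Implicit.
Unset Printing Implicit Defensive.

Import GRing.Theory.
Local Open Scope ring_scope.

Definition is_least (P : nat -> Prop) (m : nat) : Prop :=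
  P m /\ forall n, P n -> (m <= n)%N.

Section Ideals.
Variable A : comNzRingType.
Implicit Types (S I : A -> Prop) (f : A).

(* Taking m = 0 shows that the empty set generates the zero ideal. *)
Definition ideal_gen S f : Prop :=
  exists m (c g : 'I_m -> A), (forall i, S (g i)) /\ f = \sum_i c i * g i.

Definition radical I f : Prop := exists2 m, (0 < m)%N & I (f ^+ m).

End Ideals.

Section Minors.
Variables (A : comNzRingType) (m n : nat).

Definition ord_increasing p q (f : 'I_p -> 'I_q) : Prop :=
  forall i j : 'I_p, (i < j)%N -> (f i < f j)%N.

(* If p > minn m n there is no pair (f, g) as below, hence no minor. *)
Definition is_minor p (M : 'M[A]_(m, n)) (a : A) : Prop :=
  exists (f : 'I_p -> 'I_m) (g : 'I_p -> 'I_n),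
    [/\ ord_increasing f, ord_increasing g & a = \det (mxsub f g M)].

Definition minor_ideal p (M : 'M[A]_(m, n)) : A -> Prop :=
  ideal_gen (is_minor p M).

End Minors.

(* For Q = \sum_(i <= j) a_ij z_i z_j the off-diagonal entries are the a_ij and
   the diagonal entries are the 2 a_ii. Coefficients are taken in an arbitrary
   ring so that this also applies to forms whose coefficients are themselves
   polynomials. *)
Definition quad_mx (A : comNzRingType) n (Q : {mpoly A[n]}) : 'M[A]_n :=
  \matrix_(i, j) (Q@_(U_(i) + U_(j))%MM *+ (if i == j then 2 else 1)).

Definition quad_rank (K : fieldType) n (Q : {mpoly K[n]}) : nat :=
  \rank (quad_mx Q).

(* The point of P^r with homogeneous coordinates v is the line <[v]>. *)
Record pspace (K : fieldType) (r : nat) := PSpace {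
  pline :> {vspace 'rV[K]_r.+1};
  pline_dim : \dim pline = 1%N }.

Section Projective.
Variables (K : fieldType) (r : nat).
Implicit Types (X Y Z : pspace K r -> Prop) (p : pspace K r).
Implicit Types f g : {mpoly K[r.+1]}.

Definition vanishes_at f p : Prop :=
  forall v : 'rV[K]_r.+1, v \in pline p -> f.@[v ord0] = 0.

Definition vanishes_on f X : Prop := forall p, X p -> vanishes_at f p.

Definition zariski_closed X : Prop :=
  exists S : {mpoly K[r.+1]} -> Prop,
    (forall f, S f -> exists d, f \is d.-homog) /\
    (forall p, X p <-> forall f, S f -> vanishes_at f p).

Definition irreducible_variety X : Prop :=
  (exists p, X p) /\
  forall Y Z, zariski_closed Y -> zariski_closed Z ->
    (forall p, X p <-> Y p \/ Z p) ->
    (forall p, X p -> Y p) \/ (forall p, X p -> Z p).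

Definition nondegenerate_variety X : Prop :=
  forall f, f \is 1.-homog -> vanishes_on f X -> f = 0.

Definition hideal X : {mpoly K[r.+1]} -> Prop :=
  ideal_gen (fun f => (exists d, f \is d.-homog) /\ vanishes_on f X).

Definition generated_by_quadratic_forms X : Prop :=
  exists G : {mpoly K[r.+1]} -> Prop,
    (forall q, G q -> q \is 2.-homog) /\
    (forall f, hideal X f <-> ideal_gen G f).

Definition QR X (k : nat) : Prop :=
  exists G : {mpoly K[r.+1]} -> Prop,
    (forall q, G q -> q \is 2.-homog /\ (quad_rank q <= k)%N) /\
    (forall f, hideal X f <-> ideal_gen G f).

Definition is_rank_index X : nat -> Prop := is_least (QR X).

Definition basis_of_quadrics X m (Q : m.-tuple (dhomog r.+1 K 2)) : Prop :=
  free Q /\ forall q : dhomog r.+1 K 2, q \in <<Q>>%VS <-> hideal X q.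

(* The general member of the linear system spanned by the Q_k, as a form in
   the variables z with coefficients in the polynomial ring in the x_k. *)
Definition general_member m (Q : m.-tuple (dhomog r.+1 K 2)) :
    {mpoly {mpoly K[m]}[r.+1]} :=
  \sum_(k < m) 'X_k *: map_mpoly (@mpolyC m K) (tnth Q k).

End Projective.

(* Main.v *)
Require Import Defs.
From mathcomp Require Import all_boot all_order all_algebra.
From mathcomp Require Import ring zify.
From Stdlib Require Import Classical.
Import GRing.Theory.
Local Open Scope ring_scope.

Set Implicit Arguments.
Unset Strict Implicit.
Unset Printing Implicit Defensive.

(** Write [Q_v] for the member of the linear system with coordinates [v]. Since
    I(X) is generated by I(X)_2, the property QR(k) says that the [v] with
    [Q_v] of rank at most k span the space of coordinates, that is, that no
    nonzero linear form vanishes on them. They are the zeros of the minors of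
    size k + 1 of M, so by the Nullstellensatz these linear forms are the ones
    in the radical of I(k + 1, M). Moreover QR(0) fails: a quadratic form whose
    matrix is zero is the square of a linear form (in characteristic 2 it need
    not be zero), which nondegeneracy excludes from I(X).

    The Nullstellensatz is obtained by eliminating one variable at a time. Given
    equations F in A[x] and f in F of degree d with leading coefficient c, the
    zeros with c = 0 are handled by replacing f by c and f - c x^d, and those
    with c <> 0 by reducing the other equations modulo f, until only f and
    constants remain; then f divides g^d over each point of the base where c
    does not vanish, so that the coefficients of c times the pseudo-remainder of
    g^d are in the radical of the constants by induction on the number of
    variables. *)

(** * Ideals given by generators, and their radicals *)

Section IdealTheory.
Variable A : comNzRingType.
Implicit Types (S : A -> Prop) (f g : A).

Lemma ideal_gen_in S f : S f -> ideal_gen S f.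
Proof.
by move=> Sf; exists 1, (fun=> 1), (fun=> f); split=> //; rewrite big_ord1 mul1r.
Qed.

Lemma ideal_gen0 S : ideal_gen S 0.
Proof. by exists 0, (fun=> 0), (fun=> 0); split=> [[]//|]; rewrite big_ord0. Qed.

Lemma ideal_genM S c f : ideal_gen S f -> ideal_gen S (c * f).
Proof.
case=> m [d [g [Sg ->]]]; exists m, (fun i => c * d i), g; split=> //.
by rewrite big_distrr /=; apply: eq_bigr => i _; rewrite mulrA.
Qed.

Lemma ideal_genD S f g : ideal_gen S f -> ideal_gen S g -> ideal_gen S (f + g).
Proof.
case=> m [c [p [Sp ->]]] [n [d [q [Sq ->]]]].
exists (m + n)%N, (fun i => match split i with inl j => c j | inr j => d j end),
  (fun i => match split i with inl j => p j | inr j => q j end); split.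
  by move=> i; case: split.
rewrite big_split_ord; congr (_ + _); apply: eq_bigr => i _.
  by rewrite (unsplitK (inl i)).
by rewrite (unsplitK (inr i)).
Qed.

Lemma ideal_gen_sum S (I : Type) (s : seq I) (P : pred I) (F : I -> A) :
  (forall i, P i -> ideal_gen S (F i)) -> ideal_gen S (\sum_(i <- s | P i) F i).
Proof.
move=> SF; apply: big_ind => //; [exact: ideal_gen0 | exact: ideal_genD].
Qed.

End IdealTheory.

Lemma ideal_gen_morph (A B : comNzRingType) (phi : {rmorphism A -> B})
    (S : A -> Prop) (S' : B -> Prop) f :
  (forall x, S x -> ideal_gen S' (phi x)) -> ideal_gen S f ->
  ideal_gen S' (phi f).
Proof.
move=> sub [m [c [g [Sg ->]]]]; rewrite rmorph_sum /=.
by apply: ideal_gen_sum => i _; rewrite rmorphM; apply/ideal_genM/sub.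
Qed.

Section RadicalTheory.
Variable A : comNzRingType.
Implicit Types (S : A -> Prop) (f g : A).

Lemma ideal_gen_sub S S' f :
  (forall x, S x -> ideal_gen S' x) -> ideal_gen S f -> ideal_gen S' f.
Proof. exact: (@ideal_gen_morph _ _ idfun). Qed.

Lemma radical_sub S S' f :
  (forall x, S x -> ideal_gen S' x) ->
  radical (ideal_gen S) f -> radical (ideal_gen S') f.
Proof. by move=> sub [m m0 Sf]; exists m => //; apply: ideal_gen_sub Sf. Qed.

Lemma radical_in S f : ideal_gen S f -> radical (ideal_gen S) f.
Proof. by move=> Sf; exists 1. Qed.

Lemma radicalM S c f : radical (ideal_gen S) f -> radical (ideal_gen S) (c * f).
Proof. by case=> m m0 Sf; exists m => //; rewrite exprMn; apply: ideal_genM. Qed.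

Lemma radicalX S f n : radical (ideal_gen S) (f ^+ n) -> radical (ideal_gen S) f.
Proof.
case: n => [|n]; last first.
  by case=> m m0; rewrite -exprM => Sf; exists (n.+1 * m)%N; rewrite ?muln_gt0.
(* For exponent 0 the hypothesis puts 1 in the radical, which is then the whole ring. *)
rewrite expr0 => S1; rewrite -[f]mulr1; exact: radicalM.
Qed.

Lemma radicalD S f g : radical (ideal_gen S) f -> radical (ideal_gen S) g ->
  radical (ideal_gen S) (f + g).
Proof.
case=> m m0 Sf [n n0 Sg]; exists (m + n)%N; first by rewrite addn_gt0 m0.
rewrite exprDn; apply: ideal_gen_sum => i _; rewrite -mulr_natl; apply: ideal_genM.
(* In each term of the expansion of degree [m + n], either [g] has exponent at least [n] or [f] has
   exponent at least [m]. *)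
have [lein|ltni] := leqP n i.
  by rewrite -(subnK lein) exprD mulrA; apply: ideal_genM.
have le_m : (m <= m + n - i)%N by rewrite -addnBA ?leq_addr // ltnW.
by rewrite -(subnK le_m) exprD mulrAC; apply: ideal_genM.
Qed.

Lemma radical_sum S (I : Type) (s : seq I) (P : pred I) (F : I -> A) :
  (forall i, P i -> radical (ideal_gen S) (F i)) ->
  radical (ideal_gen S) (\sum_(i <- s | P i) F i).
Proof.
move=> SF; apply: big_ind => //; last exact: radicalD.
exact/radical_in/ideal_gen0.
Qed.

(* The variety of S is the union of its parts inside [c = 0] and outside. *)
Lemma radical_split S c f :
  radical (ideal_gen (fun x => x = c \/ S x)) f ->
  radical (ideal_gen S) (c * f) -> radical (ideal_gen S) f.
Proof.
case=> m m0 [k [d [g [Sg def_f]]]] [n n0 Sn].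
(* Modulo [S], only the generator [c] survives in the expression of [f ^+ m], which is thus
   congruent to a multiple [c * v]. *)
have [v Sv] : exists v, ideal_gen S (c * v - f ^+ m).
  rewrite def_f; elim: k d g Sg {def_f} => [|k IHk] d g Sg.
    by exists 0; rewrite big_ord0 mulr0 subr0; exact: ideal_gen0.
  have [v Sv] := IHk (d \o widen_ord (leqnSn k)) _
    (fun i => Sg (widen_ord (leqnSn k) i)).
  rewrite big_ord_recr /=.
  have [->|Sgk] := Sg ord_max.
    by exists (v + d ord_max); rewrite mulrDr opprD addrACA (mulrC c (d _)) subrr addr0.
  exists v; rewrite opprD addrA; apply: ideal_genD => //.
  by rewrite -mulNr; apply/ideal_genM/ideal_gen_in.
exists (m * n + n)%N; first by rewrite addn_gt0 n0 orbT.
rewrite exprD exprM.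
(* Replacing [f ^+ m] by [c * v] turns the left side into [v ^+ n * (c * f) ^+ n], whose second
   factor is in the ideal. *)
have -> : (f ^+ m) ^+ n * f ^+ n = v ^+ n * (c * f) ^+ n
    - f ^+ n * ((c * v) ^+ n - (f ^+ m) ^+ n).
  rewrite !exprMn mulrBr opprB [X in _ = X]addrC -addrA.
  rewrite [v ^+ n * _]mulrA [f ^+ n * (_ * _)]mulrC [v ^+ n * c ^+ n]mulrC.
  by rewrite addNr addr0 mulrC.
apply: ideal_genD; first exact: ideal_genM.
rewrite -mulrN; apply: ideal_genM; rewrite -mulN1r subrXX; apply: ideal_genM.
by rewrite mulrC; apply: ideal_genM.
Qed.

End RadicalTheory.

(** * Nullstellensatz *)

(* The Nullstellensatz for the K-valued points [ev t] of the ring A. *)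
Definition zero_radical (A : comNzRingType) (K : nzRingType) (T : Type)
    (ev : T -> A -> K) : Prop :=
  forall (F : seq A) (g : A),
    (forall t, {in F, forall f, ev t f = 0} -> ev t g = 0) ->
    radical (ideal_gen (fun x => x \in F)) g.

(** * Adjoining one variable *)

Section PolyStep.
Variables (K : closedFieldType) (A : comNzRingType) (T : Type).
Variable ev : T -> {rmorphism A -> K}.
Hypothesis ev_zero_radical : zero_radical (fun t => ev t : A -> K).
Implicit Types (F : seq {poly A}) (f g h r : {poly A}).

(** A point of [{poly A}] is a point of the base together with a value of the variable. *)
Let pev (ta : T * K) f : K := (map_poly (ev ta.1) f).[ta.2].

Let pevD ta f g : pev ta (f + g) = pev ta f + pev ta g.
Proof. by rewrite /pev rmorphD hornerD. Qed.
Let pevB ta f g : pev ta (f - g) = pev ta f - pev ta g.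
Proof. by rewrite /pev rmorphB hornerD hornerN. Qed.
Let pevM ta f g : pev ta (f * g) = pev ta f * pev ta g.
Proof. by rewrite /pev rmorphM hornerM. Qed.
Let pevC ta c : pev ta c%:P = ev ta.1 c.
Proof. by rewrite /pev map_polyC hornerC. Qed.

Lemma horner_ext0 (p : {poly K}) : (forall a, p.[a] = 0) -> p = 0.
Proof.
move=> p0; apply/eqP; apply: contraT => /closed_nonrootP[a].
by rewrite /root p0 eqxx.
Qed.

(** Every coefficient of [r] vanishes at the zeros of [F0], hence lies in the radical over [A]; [r]
    is a combination of its coefficients. *)
Let radical_const (F0 : seq A) r :
  (forall t, {in F0, forall c, ev t c = 0} -> map_poly (ev t) r = 0) ->
  radical (ideal_gen (fun x => x \in map polyC F0)) r.
Proof.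
move=> r0; rewrite -[r]coefK poly_def; apply: radical_sum => i _.
rewrite -mul_polyC mulrC; apply: radicalM.
have [|m m0 Sm] := ev_zero_radical (F := F0) (g := r`_i).
  by move=> t /r0 rt0; rewrite -coef_map rt0 coef0.
exists m => //; rewrite -polyC_exp; apply: ideal_gen_morph Sm => c Fc.
exact/ideal_gen_in/map_f.
Qed.

Let const_seq F : {in F, forall f, (size f <= 1)%N} ->
  F = map polyC [seq f`_0 | f : {poly A} <- F].
Proof.
move=> F1; rewrite -map_comp -[LHS]map_id; apply/eq_in_map => f /F1 f1 /=.
exact: size1_polyC.
Qed.

(* Over a point where the leading coefficient of f does not vanish, all roots
   of f are roots of g, so f divides the power of g of exponent [deg f]. *)
Let radical_one f (F0 : seq A) g :
  (forall ta, {in f :: map polyC F0, forall h, pev ta h = 0} -> pev ta g = 0) ->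
  radical (ideal_gen (fun x => x \in f :: map polyC F0)) ((lead_coef f)%:P * g).
Proof.
move=> fg0; have [->|f_neq0] := eqVneq f 0.
  by rewrite lead_coef0 mul0r; exact/radical_in/ideal_gen0.
set c := lead_coef f; set d := (size f).-1.
(* Pseudo-division, with [A] an arbitrary commutative ring: [c ^+ k *: g ^+ d = q * f + r]. *)
have := Pdiv.ComRing.rdivp_eq f (g ^+ d).
have := Pdiv.Ring.ltn_rmodp (g ^+ d) f; rewrite f_neq0.
set k := Pdiv.Ring.rscalp _ _; set q := Pdiv.Ring.rdivp _ _.
set r := Pdiv.Ring.rmodp _ _; rewrite -/c => ltr def_r.
have rad_cr : radical (ideal_gen (fun x => x \in f :: map polyC F0)) (c%:P * r).
  apply: (@radical_sub _ (fun x => x \in map polyC F0)).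
    by move=> x Fx; apply: ideal_gen_in; rewrite inE Fx orbT.
  apply: radical_const => t F0t; rewrite rmorphM /= map_polyC /=.
  have [->|c_neq0] := eqVneq (ev t c) 0; first by rewrite mul0r.
  have sz_f : size (map_poly (ev t) f) = size f by apply: size_poly_eq; rewrite -lead_coefE.
  have lc_f : lead_coef (map_poly (ev t) f) = ev t c by rewrite lead_coefE sz_f coef_map.
  have dvd_fg : map_poly (ev t) f %| map_poly (ev t) g ^+ d.
    (* Over [K] the image of [f] is, up to a nonzero scalar, a product of [d] linear factors. Each
       of them divides the image of [g], so one copy of [g] per factor suffices. *)
    have [rs def_f] := closed_field_poly_normal (map_poly (ev t) f).
    have sz_rs : size rs = d.
      rewrite /d -sz_f def_f size_scale ?lead_coef_eq0; last first.
        by rewrite -size_poly_eq0 sz_f size_poly_eq0.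
      by rewrite size_prod_XsubC.
    have root_rs a : a \in rs -> root (map_poly (ev t) g) a.
      move=> rs_a; apply/eqP/(fg0 (t, a)) => h; rewrite inE => /predU1P[->|].
        apply/eqP; rewrite -/(root _ _) def_f rootZ ?root_prod_XsubC //.
        by rewrite lc_f.
      by case/mapP=> b /F0t b0 ->; rewrite pevC.
    rewrite def_f lc_f dvdpZl // -sz_rs.
    elim: (rs) root_rs => [|a s IHs] root_s; first by rewrite big_nil dvd1p.
    rewrite big_cons exprS dvdp_mul ?dvdp_XsubCl ?root_s ?mem_head //.
    by apply: IHs => b s_b; rewrite root_s // inE s_b orbT.
  (* The image of [f] keeps its degree, which exceeds that of [r]; dividing the image of [r] forces
     the latter to be zero. *)
  have : map_poly (ev t) f %| map_poly (ev t) r.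
    have := congr1 (map_poly (ev t)) def_r.
    rewrite rmorphD rmorphM /= map_polyZ !rmorphXn /= => def_phi.
    rewrite -(dvdp_addr _ (dvdp_mulIr (map_poly (ev t) q) _)) -def_phi.
    by rewrite -mul_polyC dvdp_mull.
  have [-> _|phir_neq0 /(dvdp_leq phir_neq0)] :=
    eqVneq (map_poly (ev t) r) 0; first by rewrite mulr0.
  by rewrite sz_f leqNgt (leq_ltn_trans (size_poly _ _)).
(* The exponent makes room for [c ^+ k.+1 * g ^+ d], that is, for [c] times the pseudo-division
   identity. *)
apply: (@radicalX _ _ _ (k + 1 + d)%N).
have -> : (c%:P * g) ^+ (k + 1 + d) =
    c%:P ^+ d * g ^+ (k + 1) * (c%:P * q * f + c%:P * r).
  rewrite -[c%:P * q * f]mulrA -mulrDr -def_r -mul_polyC rmorphXn /=.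
  by rewrite exprMn !exprD !expr1; ring.
apply/radicalM/radicalD => //; apply/radicalM/radical_in/ideal_gen_in.
exact: mem_head.
Qed.

(** The measure for the elimination. Constants have degree 0, so leading coefficients can be added
    to the system for free. *)
Let degs F := (\sum_(f <- F) (size f).-1)%N.

(** The truncated predecessor gives degree 0 to the zero polynomial too; the drop is strict because
    [1 < d]. *)
Let ltn_pred_pred m d : (1 < d -> m <= d.-1 -> m.-1 < d.-1)%N.
Proof. by lia. Qed.

Let size_sub_lead f : (1 < size f)%N ->
  ((size (f - lead_coef f *: 'X^((size f).-1))%R).-1 < (size f).-1)%N.
Proof.
move=> f1; apply: ltn_pred_pred f1 _.
apply/leq_sizeP => j; rewrite coefB coefZ coefXn leq_eqVlt => /predU1P[<-|ltj].
    by rewrite eqxx mulr1 subrr.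
  rewrite gtn_eqF // mulr0 subr0 nth_default //.
  exact: leq_trans (leqSpred _) ltj.
Qed.

(** One step of pseudo-division: cross-multiplying by the leading coefficients cancels the top terms
    without inverting anything in [A]. *)
Let size_sub_cross f h : (1 < size f)%N -> (size f <= size h)%N ->
  ((size (lead_coef f *: h - lead_coef h *: ('X^(size h - size f) * f))%R).-1
     < (size h).-1)%N.
Proof.
move=> f1 le_fh; apply: ltn_pred_pred (leq_trans f1 le_fh) _.
apply/leq_sizeP => j; rewrite coefB !coefZ coefXnM.
move: f1 le_fh; rewrite !lead_coefE.
have := @nth_default _ 0 f; have := @nth_default _ 0 h.
move: (size f) (size h) => m n h0 f0 m1 le_mn.
rewrite leq_eqVlt => /predU1P[<-|ltj].
  have -> : (n.-1 < n - m)%N = false by lia.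
  have -> : (n.-1 - (n - m))%N = m.-1 by lia.
  by rewrite mulrC subrr.
by rewrite (h0 j) 1?(f0 (j - (n - m))%N) ?if_same ?mulr0 ?subr0 //; lia.
Qed.

Lemma zero_radical_poly : zero_radical pev.
Proof.
move=> F; have [n] := ubnP (degs F); elim: n F => // n IHn F.
rewrite ltnS => le_n g Fg0.
have sub_perm F1 F2 h : {subset F1 <= F2} ->
    radical (ideal_gen (fun x => x \in F1)) h ->
    radical (ideal_gen (fun x => x \in F2)) h.
  by move=> sub; apply: radical_sub => x /sub Fx; apply: ideal_gen_in.
(* Where the leading coefficient of [f] vanishes, [f] may be replaced by that coefficient and its
   lower part, and induction applies. Only the part where it does not vanish remains. *)
have split_lead f F1 : perm_eq F (f :: F1) -> (1 < size f)%N ->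
    radical (ideal_gen (fun x => x \in F)) ((lead_coef f)%:P * g) ->
    radical (ideal_gen (fun x => x \in F)) g.
  move=> permF f1; apply: radical_split.
  set c := (lead_coef f)%:P; set f' := f - lead_coef f *: 'X^((size f).-1).
  have def_f : f = f' + c * 'X^((size f).-1) by rewrite mul_polyC subrK.
  apply: (@radical_sub _ (fun x => x \in c :: f' :: F1)).
    have Fin x : x \in F -> ideal_gen (fun x => x = c \/ x \in F) x.
      by move=> Fx; apply: ideal_gen_in; right.
    have Fc : ideal_gen (fun x => x = c \/ x \in F) c.
      by apply: ideal_gen_in; left.
    move=> x; rewrite !inE => /or3P[/eqP-> // | /eqP-> | F1x].
      rewrite /f' -mul_polyC -/c mulrC -mulNr; apply: ideal_genD.
        by apply: Fin; rewrite (perm_mem permF) mem_head.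
      exact: ideal_genM.
    by apply: Fin; rewrite (perm_mem permF) inE F1x orbT.
  apply: IHn.
    apply: leq_trans le_n; rewrite /degs (perm_big _ permF) /= !big_cons.
    have -> : (size c).-1 = 0%N by rewrite size_polyC; case: (_ != 0).
    by rewrite add0n ltn_add2r size_sub_lead.
  move=> ta F'0; apply: Fg0 => h; rewrite (perm_mem permF) inE => /predU1P[->|F1h].
    rewrite def_f pevD pevM (F'0 c) ?mem_head // mul0r addr0.
    by apply: F'0; rewrite !inE eqxx orbT.
  by apply: F'0; rewrite !inE F1h !orbT.
have [/hasP[f Ff f1]|F_const] := boolP (has (fun f => 1 < size f)%N F); last first.
  rewrite (const_seq (F := F)); last first.
    by move=> f Ff; rewrite leqNgt; apply: contra F_const => f1; apply/hasP; exists f.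
  apply: radical_const => t F0; apply: horner_ext0 => a.
  apply: (Fg0 (t, a)) => f Ff.
  have f1 : (size f <= 1)%N.
    by rewrite leqNgt; apply: contra F_const => f1; apply/hasP; exists f.
  by rewrite (size1_polyC f1) pevC; apply: F0; apply: (map_f (fun f : {poly A} => f`_0)).
have permF := perm_to_rem Ff; move: (rem f F) permF => F1 permF.
(* If [f] is the only nonconstant equation, [radical_one] concludes; otherwise a second one, [h], is
   reduced modulo [f]. *)
have [/hasP[h F1h h1]|F1_const] := boolP (has (fun f => 1 < size f)%N F1); last first.
  apply: (split_lead _ _ permF f1).
  have def_F1 : F1 = map polyC [seq h`_0 | h : {poly A} <- F1].
    apply: const_seq => h F1h.
    by rewrite leqNgt; apply: contra F1_const => h1; apply/hasP; exists h.
  apply: (@sub_perm (f :: F1)) => [x|]; first by rewrite (perm_mem permF).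
  rewrite def_F1; apply: radical_one => ta; rewrite -def_F1 => F1_0.
  by apply: Fg0 => x; rewrite (perm_mem permF); apply: F1_0.
have := perm_to_rem F1h; move: (rem h F1) => F2 permF1.
have {F1 F1h permF1} permF : perm_eq F [:: f, h & F2].
  by apply: perm_trans permF _; rewrite perm_cons.
wlog le_fh : f h {Ff} f1 h1 permF / (size f <= size h)%N => [wlog_le|].
  have [|/ltnW] := leqP (size f) (size h); first exact: (wlog_le f h).
  apply: (wlog_le h f) => //; apply: perm_trans permF _.
  by rewrite (perm_catCA [:: f] [:: h] F2).
apply: (split_lead _ _ permF f1).
set h' := lead_coef f *: h - lead_coef h *: ('X^(size h - size f) * f).
apply: (@radical_sub _ (fun x => x \in [:: f, h' & F2])).
  have Fin x : x \in [:: f, h & F2] -> ideal_gen (fun x => x \in F) x.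
    by rewrite -(perm_mem permF) => Fx; apply: ideal_gen_in.
  move=> x; rewrite !inE => /or3P[/eqP-> | /eqP-> | F2x].
  - by apply: Fin; rewrite mem_head.
  - rewrite /h' -!mul_polyC -mulNr mulrA; apply: ideal_genD; apply/ideal_genM/Fin.
      by rewrite !inE eqxx orbT.
    exact: mem_head.
  - by apply: Fin; rewrite !inE F2x !orbT.
apply: IHn.
  apply: leq_trans le_n; rewrite /degs (perm_big _ permF) /= !big_cons.
  by rewrite ltn_add2l ltn_add2r size_sub_cross.
(* Since [f] vanishes here, [h' = 0] says that [lead_coef f] or [h] vanishes; in both cases
   [lead_coef f] times [g] does. *)
move=> ta F'0; have f0 : pev ta f = 0 by apply: F'0; rewrite mem_head.
have : pev ta h' = 0 by apply: F'0; rewrite !inE eqxx orbT.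
rewrite /h' -!mul_polyC pevB !pevM f0 !mulr0 subr0 => /eqP.
rewrite mulf_eq0 => /orP[/eqP-> | /eqP h0]; first by rewrite mul0r.
rewrite Fg0 ?mulr0 // => x; rewrite (perm_mem permF) !inE => /or3P[/eqP->|/eqP->|] //.
by move=> F2x; apply: F'0; rewrite !inE F2x !orbT.
Qed.

End PolyStep.

(** * Induction on the number of variables *)

Section MPolyNullstellensatz.
Variable K : closedFieldType.

Let extend n (v : 'I_n -> K) (a : K) (i : 'I_n.+1) : K :=
  oapp v a (insub (i : nat)).

Let meval_muni n v a (f : {mpoly K[n.+1]}) :
  (map_poly (meval v) (muni f)).[a] = f.@[extend v a].
Proof.
rewrite muniE mevalE rmorph_sum horner_sum; apply: eq_bigr => m _ /=.
rewrite -mul_polyC rmorphM /= map_polyC /= map_polyXn mevalZ mevalX.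
rewrite hornerM hornerC hornerXn big_ord_recr /= mulrA; congr (_ * _ * _ ^+ _).
  apply: eq_bigr => i _; rewrite mnmE /extend /=; congr (_ ^+ _).
  by rewrite (valK i).
by rewrite /extend insubF // ltnn.
Qed.

(** Needed to carry ideal membership back from polynomials in the last variable. *)
Let muni_inv n (f : {mpoly K[n.+1]}) :
  (horner_eval 'X_ord_max \o map_poly (@mwiden n K)) (muni f) = f.
Proof.
rewrite muniE [in RHS](mpolyE f) rmorph_sum; apply: eq_bigr => m _ /=.
rewrite -mul_polyC rmorphM /= map_polyC /= map_polyXn mwidenZ mwidenX.
rewrite /horner_eval hornerM hornerC hornerXn -scalerAl; congr (_ *: _).
rewrite mpolyXn -mpolyXD; congr 'X_[_]; apply/mnmP => i.
rewrite mnmDE mulmnE mnm1E; case: (unliftP ord_max i) => [j ->|->].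
  have -> : lift ord_max j = widen_ord (leqnSn n) j.
    by apply: val_inj; rewrite /= /bump leqNgt ltn_ord.
  rewrite mnmwiden_widen mnmE; case: eqP => [/(congr1 val)/= eqj|_].
    by have := ltn_ord j; rewrite -eqj ltnn.
  by rewrite mul0n addn0.
by rewrite mnmwiden_ordmax eqxx mul1n.
Qed.

Theorem nullstellensatz n : zero_radical (fun v => @meval n K v).
Proof.
elim: n => [|n IHn] F g Fg0.
  (* Without variables, [F] is either zero or contains a unit. *)
  have [/allP F0|/allPn[f Ff f_neq0]] := boolP (all (pred1 0) F).
    have -> : g = 0.
      have := Fg0 (fun=> 0); rewrite (nvar0_mpolyC g) mevalC => -> //.
      by move=> f /F0/eqP->; rewrite meval0.
    exact/radical_in/ideal_gen0.
  have -> : g = ((f@_0%MM)^-1)%:MP * g * f.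
    rewrite mulrAC [X in _ * X * _](nvar0_mpolyC f) -mpolyCM mulVf ?mpolyC1 ?mul1r //.
    by apply: contraNneq f_neq0 => f0; rewrite (nvar0_mpolyC f) f0 /= mpolyC0.
  exact/radical_in/ideal_genM/ideal_gen_in.
have [|m m0] := zero_radical_poly IHn (F := map (@muni n K) F) (g := muni g).
  move=> [v a] F0; rewrite meval_muni; apply: Fg0 => f Ff.
  by rewrite -meval_muni (F0 _ (map_f _ Ff)).
rewrite -rmorphXn => Sm; exists m => //; rewrite -[_ ^+ m]muni_inv.
apply: ideal_gen_morph Sm => _ /mapP[f Ff ->]; rewrite [X in ideal_gen _ X]muni_inv.
exact: ideal_gen_in.
Qed.

End MPolyNullstellensatz.

(** * Minors and rank *)

Section RankMinors.
Variable K : fieldType.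

(** [maxrankfun] selects independent rows in no prescribed order; enumerating the set of selected
    indices sorts them. *)
Lemma increasing_row_free m n (M : 'M[K]_(m, n)) k : (k <= \rank M)%N ->
  exists2 f : 'I_k -> 'I_m, ord_increasing f & row_free (rowsub f M).
Proof.
move=> le_k; pose f0 i := maxrankfun M (widen_ord le_k i).
pose S := [set f0 i | i : 'I_k].
have card_S : #|S| = k.
  rewrite card_imset ?card_ord // => i j /maxrankfun_inj /(congr1 val) /= eq_ij.
  exact: val_inj.
pose f i := enum_val (cast_ord (esym card_S) i).
exists f.
  move=> i j lt_ij; rewrite /f.
  have S_sorted : sorted ltn (map val (enum S)).
    rewrite /enum_mem -enumT sorted_map sorted_filter //.
      by move=> x y z; apply: ltn_trans.
    by rewrite -sorted_map val_enum_ord iota_ltn_sorted.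
  have x0 := f0 i; rewrite !(enum_val_nth x0) /=.
  have lt_S (l : 'I_k) : (l < size (enum S))%N by rewrite -cardE card_S.
  rewrite -!(nth_map x0 (val x0)) ?lt_S //.
  by apply: (sorted_ltn_nth ltn_trans (val x0) S_sorted) => //;
    rewrite inE size_map lt_S.
rewrite /row_free eqn_leq rank_leq_row.
have sub_f0 : (rowsub f0 M <= rowsub f M)%MS.
  apply/row_subP => i; rewrite row_rowsub.
  have S_i : f0 i \in S by apply: imset_f.
  have -> : f0 i = f (cast_ord card_S (enum_rank_in S_i (f0 i))).
    by rewrite /f cast_ordK enum_rankK_in.
  by rewrite -row_rowsub row_sub.
apply: leq_trans (mxrankS sub_f0).
(* The rows chosen by [f0] are the first [k] of a family of independent rows. *)
have -> : rowsub f0 M = pid_mx k *m rowsub (maxrankfun M) M.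
  apply/matrixP => i j; rewrite !mxE (bigD1 (widen_ord le_k i)) //= big1.
    by rewrite !mxE eqxx ltn_ord mul1r addr0.
  move=> l ne_li; rewrite !mxE -val_eqE /= in ne_li *.
  by rewrite eq_sym (negPf ne_li) mul0r.
by rewrite mxrankMfree ?maxrowsub_free // rank_pid_mx.
Qed.

Lemma rank_minorsP m n (M : 'M[K]_(m, n)) k :
  (\rank M <= k)%N <->
  (forall (f : 'I_k.+1 -> 'I_m) (g : 'I_k.+1 -> 'I_n),
     ord_increasing f -> ord_increasing g -> \det (mxsub f g M) = 0).
Proof.
split=> [rkM f g _ _ | det0].
  apply/eqP; apply: contraTT rkM => det_neq0; rewrite -ltnNge.
  have: row_free (mxsub f g M) by rewrite row_free_unit unitmxE unitfE.
  move/eqP <-; rewrite mxsubrc; apply: leq_trans (mxrankS (rowsub_sub _ _)) _.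
  by rewrite -mxrank_tr -[leqRHS]mxrank_tr trmx_mxsub mxrankS // rowsub_sub.
rewrite leqNgt; apply/negP => lt_k.
have [f inc_f free_f] := increasing_row_free lt_k.
(* Among the [k.+1] independent rows, [k.+1] independent columns are chosen by transposing; they
   give a nonzero minor. *)
have rk_f : (k.+1 <= \rank (rowsub f M)^T)%N by rewrite mxrank_tr (eqP free_f).
have [g inc_g free_g] := increasing_row_free rk_f.
have eq_sub : rowsub g (rowsub f M)^T = (mxsub f g M)^T.
  by apply/matrixP => i j; rewrite !mxE.
move: free_g; rewrite eq_sub row_free_unit unitmx_tr.
by rewrite unitmxE unitfE det0 // eqxx.
Qed.

(** A vector of [S] outside the row span of [W] can be appended, which raises the rank; [d] bounds
    how often this can happen. *)
Lemma spanning_rows n (S : 'rV[K]_n -> Prop) :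
  exists m (W : 'M[K]_(m, n)),
    (forall i, S (row i W)) /\ (forall v, S v -> (v <= W)%MS).
Proof.
suff extend d m (W : 'M_(m, n)) : (n - \rank W <= d)%N ->
    (forall i, S (row i W)) -> exists m (W : 'M[K]_(m, n)),
    (forall i, S (row i W)) /\ (forall v, S v -> (v <= W)%MS).
  by apply: (extend n 0 0) => [|[]//]; rewrite leq_subr.
elim: d m W => [|d IHd] m W le_d SW.
  exists m, W; split=> // v _; apply: submx_full.
  by rewrite /row_full eqn_leq rank_leq_col -subn_eq0 -leqn0.
have [W_full|/not_all_ex_not[v]] := classic (forall v, S v -> (v <= W)%MS).
  by exists m, W.
move=> not_SvW; have [Sv not_vW] := imply_to_and _ _ not_SvW.
apply: (IHd _ (col_mx W v)).
  have : (\rank W < \rank (col_mx W v))%N.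
    rewrite ltn_neqAle mxrankS ?andbT -?addsmxE ?addsmxSl //.
    apply/negP => /eqP eq_rk; apply: not_vW; apply: submx_trans (addsmxSr W v) _.
    by rewrite -(geq_leqif (mxrank_leqif_sup (addsmxSl W v))) eq_rk addsmxE.
  have := rank_leq_col (col_mx W v); lia.
move=> i; case: (split_ordP i) => [j ->|j ->]; first by rewrite rowKu.
by rewrite rowKd row_id.
Qed.


End RankMinors.

(** * Radicals of ideals of minors *)

Section MinorIdeal.
Variables (K : closedFieldType) (n p q k : nat).
Variables (M : 'M[{mpoly K[n]}]_(p, q)) (l : {mpoly K[n]}).

Lemma radical_minor_idealP :
  radical (minor_ideal k.+1 M) l <->
  (forall v, (\rank (map_mx (meval v) M) <= k)%N -> l.@[v] = 0).
Proof.
split=> [[m m0 [N [c [g [Mg def_l]]]]] v /rank_minorsP det0 | l0].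
  apply/eqP; suff: (l ^+ m).@[v] == 0 by rewrite rmorphXn expf_eq0 m0.
  rewrite def_l rmorph_sum big1 //= => i _.
  have [f1 [f2 [inc1 inc2 ->]]] := Mg i.
  by rewrite mevalM -det_map_mx map_mxsub det0 // mulr0.
(* The Nullstellensatz takes a finite sequence of equations, so the increasing maps are enumerated
   as finite functions. *)
pose incb a b (f : {ffun 'I_a -> 'I_b}) :=
  [forall i : 'I_a, forall j : 'I_a, (i < j)%N ==> (f i < f j)%N].
have incP a b (f : {ffun 'I_a -> 'I_b}) : reflect (ord_increasing f) (incb _ _ f).
  apply: (iffP forallP) => [f_inc i j lt_ij | f_inc i].
    by have /forallP/(_ j)/implyP := f_inc i; apply.
  by apply/forallP => j; apply/implyP; apply: f_inc.
pose minors := [seq \det (mxsub fg.1 fg.2 M) |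
  fg : {ffun 'I_k.+1 -> 'I_p} * {ffun 'I_k.+1 -> 'I_q} <-
    enum [pred fg | incb _ _ fg.1 && incb _ _ fg.2]].
have: radical (ideal_gen (fun x => x \in minors)) l.
  apply: nullstellensatz => v minors0; apply/l0/rank_minorsP => f g f_inc g_inc.
  rewrite -map_mxsub det_map_mx; apply: minors0; apply/mapP.
  exists (finfun f, finfun g); last by rewrite /= mxsub_ffun.
  rewrite mem_enum inE; apply/andP.
  by split; apply/incP => i j lt_ij; rewrite !ffunE; [apply: f_inc | apply: g_inc].
apply: radical_sub => x /mapP[[f g]]; rewrite mem_enum.
move=> /andP[/incP f_inc /incP g_inc] ->.
by apply: ideal_gen_in; exists f, g.
Qed.

End MinorIdeal.

(** * Linear and quadratic forms *)

Section HomogeneousForms.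
Variables (K : fieldType) (n : nat).
Implicit Types (c f g l : {mpoly K[n]}) (m : 'X_{1..n}).

Lemma mdeg2P m : mdeg m = 2 -> exists i j, m = (U_(i) + U_(j))%MM.
Proof.
move=> m2; have [i mi] : exists i, (0 < m i)%N.
  apply/existsP; apply: contra_eqT m2; rewrite negb_exists => /forallP m0.
  by rewrite mdegE big1 // => i _; apply/eqP; rewrite -leqn0 leqNgt.
have le_im : (U_(i) <= m)%MM by rewrite lep1mP -lt0n.
have: mdeg (m - U_(i)) == 1%N.
  by rewrite -(eqn_add2r 1) -{1}(mdeg1 i) -mdegD submK // m2.
by rewrite mdeg_eq1 => /existsP[j /eqP def_m]; exists j, i; rewrite -def_m submK.
Qed.

Lemma linear_form_meval l (v : 'I_n -> K) : l \is 1.-homog ->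
  l.@[v] = \sum_i l@_U_(i) * v i.
Proof.
move=> l1; have {1}-> : l = \sum_i l@_U_(i) *: 'X_i.
  apply/mpolyP => m; rewrite raddf_sum /=.
  have [m1|m1] := eqVneq (mdeg m) 1%N; last first.
    rewrite (dhomog_nemf_coeff l1) ?big1 // => i _.
    rewrite mcoeffZ mcoeffX; case: eqP => [def_m|_]; rewrite ?mulr0 //.
    by rewrite -def_m mdeg1 in m1.
  move/eqP/mdeg1P: m1 => [i /eqP->].
  rewrite (bigD1 i) //= mcoeffZ mcoeffX eqxx mulr1 big1 ?addr0 // => j ne_ji.
  by rewrite mcoeffZ mcoeffXU (negPf ne_ji) mulr0.
by rewrite rmorph_sum; apply: eq_bigr => i _; rewrite /= mevalZ mevalXU.
Qed.

Lemma linear_form_eq0 l : l \is 1.-homog -> (forall i, l@_U_(i) = 0) -> l = 0.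
Proof.
move=> l1 l0; apply/mpolyP => m; rewrite mcoeff0.
have [m1|m1] := eqVneq (mdeg m) 1%N; last by rewrite (dhomog_nemf_coeff l1).
by move/eqP/mdeg1P: m1 => [i /eqP->].
Qed.

Lemma homog0_const f : f \is 0.-homog -> f = (f@_0%MM)%:MP.
Proof.
move=> f0; apply/mpolyP => m; rewrite mcoeffC.
have [->|m_neq0] := eqVneq m 0%MM; first by rewrite mulr1.
by rewrite mulr0 (dhomog_nemf_coeff f0) // mdeg_eq0.
Qed.

(** In the component of degree [d] of a combination of forms of degree [d], only the constant terms
    of the coefficients contribute. *)
Lemma ideal_gen_homog d (G : {mpoly K[n]} -> Prop) f :
  (forall g, G g -> g \is d.-homog) -> f \is d.-homog -> ideal_gen G f ->
  exists N (a : 'I_N -> K) (g : 'I_N -> {mpoly K[n]}),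
    (forall i, G (g i)) /\ f = \sum_i a i *: g i.
Proof.
move=> homG homf [N [c [g [Gg def_f]]]].
exists N, (fun i => (pihomog mdeg 0 (c i))@_0%MM), g; split=> //.
rewrite -[LHS](pihomog_dE homf) def_f raddf_sum /=; apply: eq_bigr => i _.
rewrite -mul_mpolyC -homog0_const ?pihomogP //.
set k := mmeasure mdeg (c i).
rewrite [in LHS](pihomog_partitionE (leqnSn k)) big_distrl raddf_sum /=.
rewrite big_ord_recl /= big1 ?addr0 => [|e _].
  by rewrite pihomog_dE // -[d]add0n dhomogM ?pihomogP ?homG.
apply: (pihomog_ne0 (d := (lift ord0 e + d)%N)).
  by rewrite -[X in _ != X]add0n eqn_add2r.
by rewrite dhomogM ?pihomogP ?homG.
Qed.

(* If [2 != 0] a form with zero matrix is zero; if [2 = 0] it is diagonal,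
   hence the square of a linear form because the Frobenius map is additive. *)
Lemma quad_mx0_square (F : closedFieldType) (q : {mpoly F[n]}) :
  q \is 2.-homog -> quad_mx q = 0 ->
  exists2 l : {mpoly F[n]}, l \is 1.-homog & q = l ^+ 2.
Proof.
move=> q2 mx0.
have qij i j : i != j -> q@_(U_(i) + U_(j))%MM = 0.
  move=> ne_ij; have := congr1 (fun M => fun_of_matrix M i j) mx0.
  by rewrite !mxE (negPf ne_ij).
have qii i : q@_(U_(i) + U_(i))%MM *+ 2 = 0.
  have := congr1 (fun M => fun_of_matrix M i i) mx0.
  by rewrite !mxE eqxx.
have [char2|two_neq0] := boolP ((2%:R : F) == 0); last first.
  exists 0; first exact: dhomog0.
  rewrite expr0n; apply/mpolyP => m; rewrite mcoeff0.
  have [/mdeg2P[i [j ->]]|m2] := eqVneq (mdeg m) 2; last exact: dhomog_nemf_coeff m2.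
  have [->|/qij//] := eqVneq i j; apply/eqP.
  by have /eqP := qii j; rewrite -mulr_natr mulf_eq0 (negPf two_neq0) orbF.
(* Square roots of the diagonal coefficients are the coefficients of the linear form. *)
have [b def_b] : exists b : 'I_n -> F, forall i, b i ^+ 2 = q@_(U_(i) + U_(i))%MM.
  have sqrt_ex (a : F) : exists b, b ^+ 2 == a.
    have [b b2] := @solve_monicpoly F 2 (fun i => if i == 0%N then a else 0) isT.
    by exists b; rewrite b2 big_ord_recr big_ord1 /= mul0r addr0 mulr1.
  exists (fun i => xchoose (sqrt_ex q@_(U_(i) + U_(i))%MM)) => i.
  exact/eqP/(xchooseP (sqrt_ex _)).
exists (\sum_i b i *: 'X_i).
  by apply: rpred_sum => i _; rewrite dhomogZ // dhomogX; apply/eqP/mdeg1.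
have char2P : 2 \in [pchar {mpoly F[n]}].
  by rewrite inE /= -mpolyC_nat (eqP char2) mpolyC0 eqxx.
rewrite -[RHS](pFrobenius_autE char2P) rmorph_sum /=.
apply/mpolyP => m; rewrite raddf_sum /=.
under eq_bigr => i _ do
  rewrite pFrobenius_autE exprZn def_b mcoeffZ mpolyXn mcoeffX mulmS mulm1n.
have [/mdeg2P[i [j ->]]|m2] := eqVneq (mdeg m) 2; last first.
  rewrite (dhomog_nemf_coeff q2 m2) big1 // => i _.
  case: eqP => [def_m|_]; rewrite ?mulr0 //.
  by rewrite -def_m mdegD !mdeg1 in m2.
have eq_UU k : (U_(k) + U_(k) == U_(i) + U_(j))%MM = (k == i) && (i == j).
  apply/eqP/andP => [/mnmP eq_U|[/eqP-> /eqP->] //].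
  have := eq_U i; have := eq_U j; rewrite !mnmDE !mnm1E !eqxx (eq_sym j i).
  by case: (k == i); case: (k == j); case: (i == j).
under eq_bigr => k _ do rewrite eq_UU.
rewrite (bigD1 i) //= eqxx big1 ?addr0 => [|k /negPf->]; last by rewrite mulr0.
by have [->|ne_ij] := eqVneq i j; rewrite ?mulr1 // mulr0 qij.
Qed.

End HomogeneousForms.

(** * Rank index *)

Lemma ex_least (P : nat -> Prop) : (exists n, P n) -> exists k, is_least P k.
Proof.
case=> n; elim/ltn_ind: n => n IHn Pn.
have [[m [lt_mn Pm]]|no_lt] := classic (exists m, (m < n)%N /\ P m).
  exact: IHn lt_mn Pm.
exists n; split=> // m Pm; rewrite leqNgt; apply/negP => lt_mn.
by apply: no_lt; exists m.
Qed.

(** Relates the minors of the matrix of the general member to the ranks of the individual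
    members. *)
Lemma general_member_meval (K : fieldType) (r m : nat)
    (Q : m.-tuple (dhomog r.+1 K 2)) (v : 'I_m -> K) :
  map_mx (meval v) (quad_mx (general_member Q)) =
  quad_mx (\sum_(k < m) v k *: (tnth Q k : {mpoly K[r.+1]})).
Proof.
apply/matrixP => i j; rewrite !mxE mevalMn; congr (_ *+ _).
rewrite /general_member !raddf_sum /=; apply: eq_bigr => k _.
by rewrite !mcoeffZ mcoeff_map_mpoly mevalM mevalXU mevalC.
Qed.

Section RankIndex.
Variables (K : closedFieldType) (r : nat) (X : pspace K r -> Prop).
Hypothesis X_nondegenerate : nondegenerate_variety X.
Hypothesis X_quadratic : generated_by_quadratic_forms X.
Variables (t : nat) (Q : t.+1.-tuple (dhomog r.+1 K 2)).
Hypothesis Q_basis : basis_of_quadrics X Q.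

Let M := quad_mx (general_member Q).

Let Q_free : free Q. Proof. by case: Q_basis. Qed.

Lemma hideal_vanishes f : hideal X f -> vanishes_on f X.
Proof.
case=> m [c [g [Xg ->]]] p Xp v pv; rewrite rmorph_sum big1 //= => i _.
by rewrite mevalM (proj2 (Xg i) p Xp v pv) mulr0.
Qed.

Lemma quadric_rank0 q : q \is 2.-homog -> hideal X q -> (quad_rank q <= 0)%N ->
  q = 0.
Proof.
move=> q2 Xq; rewrite leqn0 mxrank_eq0 => /eqP/(quad_mx0_square q2)[l l1 def_q].
rewrite def_q (X_nondegenerate l1) ?expr0n // => p Xp v pv.
have /eqP := hideal_vanishes Xq Xp pv.
by rewrite def_q rmorphXn expf_eq0 /= => /eqP.
Qed.

Lemma quadric_coord (q : dhomog r.+1 K 2) : hideal X q ->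
  (q : {mpoly K[r.+1]}) = \sum_(k < t.+1) coord Q k q *: (tnth Q k : {mpoly K[r.+1]}).
Proof.
move=> /(proj2 Q_basis) Qq; rewrite {1}(coord_span Qq) raddf_sum /=.
by apply: eq_bigr => k _; rewrite (tnth_nth 0).
Qed.

Lemma hideal_basis k : hideal X (tnth Q k).
Proof. by apply/(proj2 Q_basis); rewrite memv_span // mem_tnth. Qed.

Definition no_linear_form s := (1 <= s)%N /\
  forall l : {mpoly K[t.+1]}, l \is 1.-homog ->
    radical (minor_ideal s.+1 M) l -> l = 0.

(** Each basis quadric is a scalar combination of generators of rank at most [k], so a linear form
    vanishing at the coordinates of the latter vanishes at every unit vector. *)
Lemma QR_no_linear_form k : QR X k -> no_linear_form k.
Proof.
case=> G [homG genG].
have GX q : G q -> hideal X q by move=> Gq; apply/genG/ideal_gen_in.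
have decomp i : exists N (a : 'I_N -> K) (g : 'I_N -> dhomog r.+1 K 2),
    (forall j, G (g j)) /\ tnth Q i = \sum_j a j *: g j.
  have [|||N [a [g [Gg def_Qi]]]] := @ideal_gen_homog _ _ 2 G (tnth Q i).
  - by move=> q /homG[].
  - exact: dhomog_is_dhomog.
  - exact/genG/hideal_basis.
  exists N, a, (fun j => DHomog (proj1 (homG _ (Gg j)))); split=> //.
  by apply: val_inj; rewrite /= raddf_sum def_Qi; apply: eq_bigr.
split=> [|l l1 /radical_minor_idealP l0].
  (* With [k = 0] all generators used are zero, and so is the first basis quadric, against
     freeness. *)
  rewrite lt0n; apply/eqP => k0; have [N [a [g [Gg]]]] := decomp ord0.
  rewrite big1 => [Q0|j _].
    have := free_not0 Q_free (mem_tnth ord0 Q).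
    by rewrite Q0 eqxx.
  have g0 : (g j : {mpoly K[r.+1]}) = 0.
    have [g2 rk_g] := homG _ (Gg j); apply: quadric_rank0 g2 (GX _ (Gg j)) _.
    by rewrite k0 in rk_g.
  by apply: val_inj; rewrite /= g0 scaler0.
apply: (linear_form_eq0 l1) => i; have [N [a [g [Gg def_Qi]]]] := decomp i.
have -> : l@_U_(i) = l.@[fun k => coord Q k (tnth Q i)].
  rewrite (linear_form_meval _ l1) (bigD1 i) //= (tnth_nth 0) coord_free //.
  rewrite eqxx mulr1 big1 ?addr0 // => k0 ne_k0i.
  by rewrite coord_free // eq_sym (negPf ne_k0i) mulr0.
have -> : l.@[fun k => coord Q k (tnth Q i)] =
    \sum_j a j * l.@[fun k => coord Q k (g j)].
  under eq_bigr => j _ do rewrite (linear_form_meval _ l1) big_distrr.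
  rewrite exchange_big (linear_form_meval _ l1); apply: eq_bigr => k0 _ /=.
  rewrite def_Qi linear_sum big_distrr; apply: eq_bigr => j _ /=.
  by rewrite linearZ /= mulrCA.
rewrite big1 // => j _; rewrite l0 ?mulr0 // general_member_meval.
by rewrite -quadric_coord; [case: (homG _ (Gg j)) | apply: GX].
Qed.

Lemma no_linear_form_QR k : no_linear_form k -> QR X k.
Proof.
case=> _ no_l.
pose lin (v : 'rV[K]_t.+1) : {mpoly K[r.+1]} :=
  \sum_k v 0 k *: (tnth Q k : {mpoly K[r.+1]}).
have [N [W [SW spanW]]] := spanning_rows (fun v => quad_rank (lin v) <= k)%N.
(* A column of [cokermx W] is a linear form vanishing on the row span of [W], hence at all [v]
   giving rank at most [k]; it lies in the radical and is therefore zero. *)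
have W_full : row_full W.
  rewrite -cokermx_eq0; apply/eqP/matrixP => i j; rewrite [RHS]mxE.
  pose l : {mpoly K[t.+1]} := \sum_i cokermx W i j *: 'X_i.
  have lU i0 : l@_U_(i0) = cokermx W i0 j.
    rewrite raddf_sum (bigD1 i0) //= big1 ?addr0 => [|i1 /negPf ne_i1].
      by rewrite mcoeffZ mcoeffXU eqxx mulr1.
    by rewrite mcoeffZ mcoeffXU ne_i1 mulr0.
  have l1 : l \is 1.-homog.
    by apply: rpred_sum => i0 _; rewrite dhomogZ // dhomogX; apply/eqP/mdeg1.
  rewrite -lU (no_l l l1) ?mcoeff0 //; apply/radical_minor_idealP => v rk_v.
  have /submxP[y def_v] : (\row_i v i <= W)%MS.
    apply: spanW; rewrite general_member_meval in rk_v.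
    rewrite /lin; under eq_bigr => i0 _ do rewrite mxE.
    exact: rk_v.
  have <- : (\row_i v i *m cokermx W) 0 j = 0.
    by rewrite def_v -mulmxA mulmx_coker mulmx0 mxE.
  rewrite (linear_form_meval _ l1) [RHS]mxE; apply: eq_bigr => i0 _.
  by rewrite lU mulrC; congr (_ * _); rewrite mxE.
exists (fun q => [/\ q \is 2.-homog, hideal X q & (quad_rank q <= k)%N]).
split=> [q []//|f]; split; last by apply: ideal_gen_sub => q [].
have linX v : hideal X (lin v).
  apply: ideal_gen_sum => i _; rewrite -mul_mpolyC.
  exact/ideal_genM/hideal_basis.
have lin2 v : lin v \is 2.-homog.
  by apply: rpred_sum => i _; apply: dhomogZ; exact: dhomog_is_dhomog.
have [G [homG genG]] := X_quadratic; move/genG; apply: ideal_gen_sub => q Gq.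
have Xq : hideal X q by apply/genG/ideal_gen_in.
have def_q := @quadric_coord (DHomog (homG _ Gq)) Xq.
have /submxP[y def_y] : (\row_i coord Q i (DHomog (homG _ Gq)) <= W)%MS.
  exact: submx_full.
(* As [W] spans the coordinate space, every quadric in the ideal is a combination of the members
   given by its rows, which have rank at most [k]. *)
have -> : q = \sum_j y 0 j *: lin (row j W).
  rewrite [LHS]def_q; under [RHS]eq_bigr => j _ do rewrite /lin scaler_sumr.
  rewrite exchange_big; apply: eq_bigr => i _ /=.
  have := congr1 (fun u => fun_of_matrix u 0 i) def_y; rewrite !mxE => ->.
  by rewrite scaler_suml; apply: eq_bigr => j _; rewrite scalerA mxE.
apply: ideal_gen_sum => j _; rewrite -mul_mpolyC; apply/ideal_genM/ideal_gen_in.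
by split=> //; apply: SW.
Qed.

End RankIndex.

Theorem proposition2p1 (K : closedFieldType) (r : nat) (X : pspace K r -> Prop)
    (X_closed : zariski_closed X) (X_irreducible : irreducible_variety X)
    (X_nondegenerate : nondegenerate_variety X)
    (X_quadratic : generated_by_quadratic_forms X)
    (t : nat) (Q : t.+1.-tuple (dhomog r.+1 K 2))
    (Q_basis : basis_of_quadrics X Q) :
  let M : 'M[{mpoly K[t.+1]}]_r.+1 := quad_mx (general_member Q) in
  exists k : nat,
    is_rank_index X k /\
    is_least (fun s : nat => (1 <= s)%N /\
        forall l : {mpoly K[t.+1]}, l \is 1.-homog ->
          radical (minor_ideal s.+1 M) l -> l = 0) k.
Proof.
(* QR(r + 1) holds because the matrices have size r + 1, so a least [k] exists; the two implications
   then show that it is also the other minimum. *)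
move=> M; have [|k [QRk min_k]] := @ex_least (QR X).
  have [G [homG genG]] := X_quadratic; exists r.+1, G; split=> // q Gq.
  by split; [exact: homG | exact: rank_leq_row].
exists k; split=> //; split; first exact: (QR_no_linear_form X_nondegenerate Q_basis QRk).
by move=> s no_l; apply: min_k; apply: (no_linear_form_QR X_quadratic Q_basis).
Qed.
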